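(* Let $\phi:\mathbb{D}\to\mathbb{D}$ be a holomorphic map such that the composition operator $C_\phi:\mathcal{H}^2_2(\mathbb{D})\to\mathcal{H}^2_2(\mathbb{D})$ is complex symmetric with conjugation $\mathcal{J}$. Then $\phi(0)=0$ and $\phi(z)=az$ for all $z\in\mathbb{D}$, where $a=\phi'(0)$. Conversely, if $\phi(z)=az$ maps the unit disk into itself, where $a\in\mathbb{D}$, then the composition operator $C_\phi:\mathcal{H}^2_2(\mathbb{D})\to\mathcal{H}^2_2(\mathbb{D})$ is complex symmetric with conjugation $\mathcal{J}$.
   Context: $\mathbb{D}$ is the open unit disk in $\mathbb{C}$ and $H(\mathbb{D})$ is the space of holomorphic functions on $\mathbb{D}$. $\mathcal{H}^2_2(\mathbb{D})$ is the Hilbert space of all $f(z)=\sum_{n\ge0}a_nz^n\in H(\mathbb{D})$ with $\|f\|^2_{\mathcal{H}^2_2}=\sum_{n\ge0}\frac{(n+2)^5}{n+1}|a_n|^2<\infty$, with inner product $\langle \sum a_nz^n,\sum b_nz^n\rangle_{\mathcal{H}^2_2}=\sum_{n\ge0}\frac{(n+2)^5}{n+1}a_n\overline{b_n}$. Its reproducing kernel at $w\in\mathbb{D}$ is $K_w(z)=\sum_{n\ge0}\frac{n+1}{(n+2)^5}(\overline{w}z)^n$. For holomorphic $\phi:\mathbb{D}\to\mathbb{D}$, $C_\phi f=f\circ\phi$. A conjugation on a complex Hilbert space $\mathcal{H}$ is an antilinear map $\mathcal{C}:\mathcal{H}\to\mathcal{H}$ with $\mathcal{C}^2=I$ and $\langle\mathcal{C}x,\mathcal{C}y\rangle=\langle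 y,x\rangle$ for all $x,y\in\mathcal{H}$. A bounded linear operator $T$ on $\mathcal{H}$ is complex symmetric with conjugation $\mathcal{C}$ if $T\mathcal{C}=\mathcal{C}T^*$. $\mathcal{J}$ is the conjugation on $\mathcal{H}^2_2(\mathbb{D})$ given by $(\mathcal{J}f)(z)=\overline{f(\overline{z})}$, so that $\mathcal{J}K_w=K_{\overline{w}}$. *)

(* Defs.v *)
From HB Require Import structures.
From mathcomp Require Import all_boot all_order all_algebra.
From mathcomp Require Import complex.
From mathcomp Require Import all_classical all_reals all_analysis.
From mathcomp Require Import ring lra.
Import Order.TTheory GRing.Theory Num.Theory numFieldNormedType.Exports.

Set Implicit Arguments.
Unset Strict Implicit.
Unset Printing Implicit Defensive.

Local Open Scope classical_set_scope.
Local Open Scope ring_scope.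

(* The field of complex numbers over R, packed as a numClosedFieldType: its
   topology is then the one mathcomp-analysis puts on any numClosedFieldType,
   and [derivable f z 1], [derive1 f z] are complex differentiability and the
   complex derivative. *)
Definition Cplx (R : realType) : numClosedFieldType := R[i].

Section Operators.
Variables (R : realType) (H : lmodType (Cplx R)) (ip : H -> H -> Cplx R).

Definition hnorm (x : H) : R := Num.sqrt (complex.Re (ip x x)).

Definition bounded_linear (T : H -> H) : Prop :=
  linear T /\ exists M : R, forall x, hnorm (T x) <= M * hnorm x.

Definition is_adjoint (T S : H -> H) : Prop :=
  forall x y, ip (T x) y = ip x (S y).

Definition antilinear (A : H -> H) : Prop :=
  forall (c : Cplx R) x y, A (c *: x + y) = c^* *: A x + A y.

Definition conjugation (A : H -> H) : Prop :=
  [/\ antilinear A, forall x, A (A x) = x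
    & forall x y, ip (A x) (A y) = ip y x].

(* S is the adjoint of T; it exists and is unique on a Hilbert space. *)
Definition complex_symmetric (T A : H -> H) : Prop :=
  [/\ conjugation A, bounded_linear T
    & exists S : H -> H, is_adjoint T S /\ forall x, T (A x) = A (S x)].

End Operators.

Definition disk (R : realType) : set (Cplx R) := [set z | `|z| < 1].

Definition holomorphic_on_disk (R : realType) (f : Cplx R -> Cplx R) : Prop :=
  forall z, disk z -> derivable f z 1.

Definition maps_disk_into_disk (R : realType) (f : Cplx R -> Cplx R) : Prop :=
  forall z, disk z -> disk (f z).

Definition weight (K : numFieldType) (n : nat) : K :=
  (n + 2)%:R ^+ 5 / (n + 1)%:R.

Definition power_expansion (R : realType) (f : Cplx R -> Cplx R)
    (a : nat -> Cplx R) : Prop :=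
  forall z, disk z -> series (fun n => a n * z ^+ n) @ \oo --> f z.

Definition modulus (R : realType) (c : Cplx R) : R := complex.Re `|c|.

Definition finite_H22_norm (R : realType) (a : nat -> Cplx R) : Prop :=
  (\sum_(0 <= n <oo) (weight R n * modulus (a n) ^+ 2)%:E < +oo)%E.

(* A function on the disk is represented by its extension by 0 to the whole
   plane, so that equality of elements of H22 is equality on the disk. *)
Definition in_H22 (R : realType) (f : Cplx R -> Cplx R) : Prop :=
  [/\ forall z, ~ disk z -> f z = 0,
      holomorphic_on_disk f
    & exists a, power_expansion f a /\ finite_H22_norm a].

Definition H22_pred (R : realType) : {pred (Cplx R -> Cplx R)} :=
  [pred f | `[< in_H22 f >]].

Lemma weight_ge0 (K : numFieldType) n : 0 <= weight K n.
Proof. by rewrite divr_ge0 ?exprn_ge0 ?ler0n. Qed.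

Section H22_closed.
Variable R : realType.
Implicit Types (c x y z : Cplx R) (a b : nat -> Cplx R) (f g : Cplx R -> Cplx R).

Lemma modulusE x : `|x| = (modulus x)%:C%C.
Proof. by rewrite /modulus RRe_real // normr_real. Qed.

Lemma modulus_ge0 x : 0 <= modulus x.
Proof. by rewrite -lecR -modulusE normr_ge0. Qed.

Lemma modulusM x y : modulus (x * y) = modulus x * modulus y.
Proof. by apply: (@complexI R); rewrite rmorphM /= -!modulusE normrM. Qed.

Lemma modulus_conj x : modulus x^* = modulus x.
Proof. by rewrite /modulus norm_conjC. Qed.

Lemma ler_modulusD x y : modulus (x + y) <= modulus x + modulus y.
Proof. by rewrite -lecR rmorphD /= -!modulusE ler_normD. Qed.

Lemma finite_H22_normZD c a b : finite_H22_norm a -> finite_H22_norm b ->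
  finite_H22_norm (fun n => c * a n + b n).
Proof.
move=> fa fb; rewrite /finite_H22_norm.
pose A n := (weight R n * modulus (a n) ^+ 2)%:E.
pose B n := (weight R n * modulus (b n) ^+ 2)%:E.
have A0 n : (0 <= A n)%E by rewrite lee_fin mulr_ge0 ?weight_ge0 ?sqr_ge0.
have B0 n : (0 <= B n)%E by rewrite lee_fin mulr_ge0 ?weight_ge0 ?sqr_ge0.
apply: (@le_lt_trans _ _ (\sum_(0 <= n <oo)
    ((2 * modulus c ^+ 2)%:E * A n + 2%:E * B n))%E).
  apply: lee_nneseries => [n _ _|n _].
    by rewrite lee_fin mulr_ge0 ?weight_ge0 ?sqr_ge0.
  rewrite /A /B -!EFinM -EFinD lee_fin.
  have -> : 2 * modulus c ^+ 2 * (weight R n * modulus (a n) ^+ 2) +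
      2 * (weight R n * modulus (b n) ^+ 2) =
      weight R n * (2 * (modulus c * modulus (a n)) ^+ 2 +
                    2 * modulus (b n) ^+ 2) by ring.
  apply: ler_wpM2l; first exact: weight_ge0.
  rewrite -modulusM; set u := c * a n; set v := b n.
  apply: (@le_trans _ _ ((modulus u + modulus v) ^+ 2)).
    by rewrite ler_sqr ?nnegrE ?addr_ge0 ?modulus_ge0 // ler_modulusD.
  have := sqr_ge0 (modulus u - modulus v); nra.
have c0 : 0 <= 2 * modulus c ^+ 2 by rewrite mulr_ge0 ?sqr_ge0.
rewrite nneseriesD; last 2 first.
- by move=> n _ _; rewrite mule_ge0.
- by move=> n _ _; rewrite mule_ge0.
rewrite !nneseriesZl //; apply: lte_add_pinfty.
- by rewrite lte_mul_pinfty.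
- by rewrite lte_mul_pinfty.
Qed.

Lemma in_H22_0 : in_H22 (0 : Cplx R -> Cplx R).
Proof.
split; [by []|by move=> z _; exact: derivable_cst|].
exists (fun=> 0); split.
  move=> z _; apply: cvg_near_cst; apply: nearW => n.
  by rewrite /series /= big1 // => i _; rewrite mul0r.
rewrite /finite_H22_norm eseries0 ?ltry// => n _ _.
by rewrite /modulus normr0 /= expr0n /= mulr0.
Qed.

Lemma in_H22_ZD c f g : in_H22 f -> in_H22 g -> in_H22 (c *: f + g).
Proof.
move=> [f0 fd [a [fa na]]] [g0 gd [b [gb nb]]]; split.
- by move=> z zD; rewrite !fctE f0 // g0 // scaler0 addr0.
- move=> z zD; apply: derivableD; last exact: gd.
  by apply: derivableZ; exact: fd.
exists (fun n => c * a n + b n); split; last exact: finite_H22_normZD.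
move=> z zD.
have -> : series (fun n => (c * a n + b n) * z ^+ n) =
    c *: series (fun n => a n * z ^+ n) + series (fun n => b n * z ^+ n).
  apply/funext => n; rewrite !fctE /series /= scaler_sumr -big_split /=.
  by apply: eq_bigr => i _; rewrite mulrDl -mulrA.
apply: cvgD; last exact: gb.
by apply: cvgZr; exact: fa.
Qed.

Lemma H22_submod_closed : submod_closed (@H22_pred R).
Proof.
split=> [|c f g /asboolP Hf /asboolP Hg]; apply/asboolP.
- exact: in_H22_0.
- exact: in_H22_ZD.
Qed.

HB.instance Definition _ := GRing.isSubmodClosed.Build (Cplx R)
  (Cplx R -> Cplx R) (@H22_pred R) H22_submod_closed.

End H22_closed.

Record H22 (R : realType) := MkH22 {
  H22_fun :> Cplx R -> Cplx R;
  _ : H22_fun \in @H22_pred R }.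

Section H22_lmodule.
Variable R : realType.
HB.instance Definition _ := [isSub for @H22_fun R].
HB.instance Definition _ := [Choice of H22 R by <:].
HB.instance Definition _ := [SubChoice_isSubLmodule of H22 R by <:].
End H22_lmodule.

(* The Taylor coefficients of f, unique when an expansion exists. *)
Definition coefs (R : realType) (f : Cplx R -> Cplx R) : nat -> Cplx R :=
  xget (fun=> 0) [set a | power_expansion f a].

Definition H22_ip (R : realType) (f g : H22 R) : Cplx R :=
  limn (series (fun n => weight (Cplx R) n * coefs f n * (coefs g n)^*)).

Section J.
Variable R : realType.
Implicit Types (f : Cplx R -> Cplx R) (z : Cplx R).

Definition conj_fun f : Cplx R -> Cplx R := fun z => (f z^*)^*.

Lemma disk_conj z : disk z -> disk z^*.
Proof. by rewrite /disk /= norm_conjC. Qed.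

Lemma cvg_conj (T : Type) (F : set_system T) (FF : Filter F)
    (u : T -> Cplx R) (l : Cplx R) :
  u @ F --> l -> (fun t => (u t)^*) @ F --> l^*.
Proof.
move=> /cvgrPdist_lt ul; apply/cvgrPdist_lt => e e0.
near=> t; rewrite -rmorphB norm_conjC; near: t; exact: ul.
Unshelve. all: by end_near. Qed.

Lemma cvg_conj_dnbhs0 : (fun h : Cplx R => h^*) @ (0 : Cplx R)^' --> (0 : Cplx R)^'.
Proof.
move=> A /nbhs_ballP[e /= e0 eA]; apply/nbhs_ballP; exists e => //= h he h0.
apply: eA; last by rewrite conjC_eq0.
by move: he; rewrite /ball /= !sub0r !normrN norm_conjC.
Qed.

Lemma conj_fun_derivable f z : derivable f z^* 1 -> derivable (conj_fun f) z 1.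
Proof.
move=> /cvg_ex[l fl]; apply/cvg_ex; exists l^*.
pose u h := h^-1 *: ((f \o shift z^*) (h *: (1 : Cplx R)) - f z^*).
have ul : u @ (0 : Cplx R)^' --> l := fl.
set v := (fun h => h^-1 *: _).
have -> : v = (fun h => (u h^*)^*); last first.
  exact: (cvg_conj _ (cvg_comp _ _ cvg_conj_dnbhs0 ul)).
apply/funext => h; rewrite /v /u /conj_fun /= /GRing.scale /= !mulr1.
by rewrite rmorphM rmorphB fmorphV /= conjCK !rmorphD.
Qed.

Lemma in_H22_conj f : in_H22 f -> in_H22 (conj_fun f).
Proof.
move=> [f0 fd [a [fa na]]]; split.
- move=> z zD; rewrite /conj_fun f0 ?conjC0 // => /disk_conj.
  by rewrite conjCK.
- by move=> z zD; apply: conj_fun_derivable; apply: fd; exact: disk_conj.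
exists (fun n => (a n)^*); split.
  move=> z /disk_conj zD.
  set v := series _.
  have -> : v = (fun n => (series (fun k => a k * z^* ^+ k) n)^*); last first.
    exact: (cvg_conj _ (fa _ zD)).
  apply/funext => n; rewrite /v /series /= rmorph_sum; apply: eq_bigr => i _.
  by rewrite rmorphM rmorphXn /= conjCK.
by move: na; rewrite /finite_H22_norm; under eq_eseriesr do rewrite -modulus_conj.
Qed.

Lemma H22_conj_subproof (f : H22 R) : conj_fun f \in @H22_pred R.
Proof. by case: f => f /= /asboolP Hf; apply/asboolP; exact: in_H22_conj. Qed.

Definition J (f : H22 R) : H22 R := MkH22 (H22_conj_subproof f).

End J.

Definition is_composition_operator (R : realType) (phi : Cplx R -> Cplx R)
    (T : H22 R -> H22 R) : Prop :=
  forall (f : H22 R) z, disk z -> T f z = f (phi z).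

(* The first conjunct says that f \o phi belongs to H22 for every f in H22;
   it determines T. *)
Definition composition_complex_symmetric (R : realType)
    (phi : Cplx R -> Cplx R) (A : H22 R -> H22 R) : Prop :=
  exists T : H22 R -> H22 R,
    is_composition_operator phi T /\ complex_symmetric (@H22_ip R) T A.

(* Main.v *)
(** Write [e_n] for the monomial [z ^ n] and [w_n] for the weight. If the adjoint
    of [C_phi] is [J C_phi J], comparing [<C_phi e_n, e_m>] with
    [<e_n, J C_phi J e_m>] gives [w_m [z^m] phi^n = w_n [z^n] phi^m]. With [n = 0],
    [m = 1] this says [phi 0 = 0]; hence [phi^m = O(z^2)] for [m >= 2], and the
    case [n = 1] kills every coefficient of [phi] of order at least two.
    Conversely, the dilation by [a] multiplies the [n]-th coefficient by [a ^ n],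
    so its adjoint is the dilation by [a^*]. *)
Require Import Defs.
From mathcomp Require Import all_boot all_order all_algebra.
From mathcomp Require Import complex.
From mathcomp Require Import all_classical all_reals all_analysis.
From mathcomp Require Import ring.
Import Order.TTheory GRing.Theory Num.Theory numFieldNormedType.Exports.
Local Open Scope ring_scope.

Lemma weight_neq0 (K : numFieldType) n : weight K n != 0.
Proof.
by rewrite mulf_neq0 ?expf_neq0 ?invr_neq0 ?pnatr_eq0// ?addn1 ?addn2.
Qed.

(** * Taylor remainders and uniqueness of power series expansions on the disk *)

Section PowerSeries.
Variable R : realType.
Implicit Types (F : Cplx R -> Cplx R) (a b : nat -> Cplx R) (z : Cplx R).

Lemma power_series_remainder F b N : power_expansion F b ->
  exists2 C : Cplx R, 0 <= C & forall z, `|z| <= 4^-1 ->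
    `|F z - \sum_(0 <= k < N) b k * z ^+ k| <= C * `|z| ^+ N.
Proof.
(* The terms of the series tend to 0 at 1/2, so [b n = O(2 ^ n)] and for
   [|z| <= 1/4] the tail is geometric of ratio [x = |2 z| <= 1/2]. *)
move=> Fb; have half_disk : disk (2^-1 : Cplx R).
  by rewrite /disk /= ger0_norm ?invr_ge0 ?ler0n// invf_lt1 ?ltr0n// ltr1n.
have [M [Mreal bM]] := cvg_seq_bounded
  (cvgP _ (cvg_series_cvg_0 (cvgP _ (Fb _ half_disk)))).
have {}bM n : `|b n * 2^-1 ^+ n| <= `|M| + 1.
  apply: bM => //; rewrite (le_lt_trans (real_ler_norm Mreal))//.
  by rewrite ltrDl.
have M0 : 0 <= `|M| + 1 by rewrite addr_ge0.
(* The factor [2] bounds the geometric sum [1 / (1 - x)], and [2 ^+ N] comes from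
   [x ^+ N = 2 ^+ N * |z| ^+ N]. *)
exists (2 * (`|M| + 1) * 2 ^+ N); first by rewrite !mulr_ge0 ?exprn_ge0.
move=> z z4; set x := `|2 * z|.
have x0 : 0 <= x by rewrite normr_ge0.
have x2 : 2 * x <= 1.
  rewrite /x normrM ger0_norm// mulrA -natrM.
  by rewrite -(@ler_pM2l _ 4^-1) ?invr_gt0// mulKf ?mulr1.
have zD : disk z.
  by rewrite /disk /= (le_lt_trans z4)// invf_lt1 ?ltr0n// ltr1n.
have term n : `|b n * z ^+ n| <= (`|M| + 1) * x ^+ n.
  rewrite (_ : b n * z ^+ n = b n * 2^-1 ^+ n * (2 * z) ^+ n); last first.
    by rewrite exprMn mulrA -(mulrA (b n)) -exprMn mulVf// expr1n mulr1.
  by rewrite normrM normrX ler_wpM2r ?exprn_ge0.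
(* Keeping the term [- x ^+ n] lets the induction telescope: the step amounts to
   [x ^+ n <= 2 * (x ^+ n - x ^+ n.+1)], that is [2 * x <= 1]. *)
have partial n : (N <= n)%N ->
    `|series (fun k => b k * z ^+ k) n - \sum_(0 <= k < N) b k * z ^+ k|
    <= 2 * (`|M| + 1) * (x ^+ N - x ^+ n).
  elim: n => [|n IH].
    by rewrite leqn0 => /eqP ->; rewrite /series/= !subrr normr0 mulr0.
  rewrite leq_eqVlt => /predU1P[->|]; first by rewrite /series/= !subrr normr0 mulr0.
  rewrite ltnS => Nn; rewrite /series/= big_nat_recr//= addrAC.
  apply: (le_trans (ler_normD _ _)).
  apply: (le_trans (lerD (IH Nn) (term n))).
  rewrite -subr_ge0 [X in 0 <= X](_ : _ = (`|M| + 1) * (x ^+ n * (1 - 2 * x))).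
    by rewrite !mulr_ge0 ?exprn_ge0 ?subr_ge0.
  by rewrite exprS; ring.
(* Passage to the limit: the index [maxn m N] is large enough both for [F z] to be within [e] of the
   partial sum and for [partial] to apply. *)
apply/ler_addgt0Pr => e e0.
have /cvgrPdist_le/(_ e e0)[m _ mF] := Fb _ zD.
have {mF} := mF (maxn m N) (leq_maxl _ _) => /= mF.
rewrite -(subrKA (series (fun k => b k * z ^+ k) (maxn m N))).
apply: (le_trans (ler_normD _ _)); rewrite addrC; apply: lerD => //.
apply: (le_trans (partial _ (leq_maxr _ _))).
rewrite -!mulrA ler_pM2l// ler_wpM2l// -exprMn.
have -> : 2 * `|z| = x by rewrite /x normrM ger0_norm.
by rewrite gerBl exprn_ge0.
Qed.

(** Strong induction: once the coefficients below [k] vanish, [b k * z ^+ k] is [F z] minus a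
    remainder of order [k.+1]. Dividing by [|z| ^+ k] bounds [|b k|] by a multiple of [|z|], and [z]
    may be taken small. *)
Lemma power_series_coef_eq0 F b (C : Cplx R) n : power_expansion F b -> 0 <= C ->
  (forall z, `|z| <= 4^-1 -> `|F z| <= C * `|z| ^+ n.+1) ->
  forall k, (k <= n)%N -> b k = 0.
Proof.
move=> Fb C0 FC; elim/ltn_ind => k IH kn.
have [D D0 FD] := power_series_remainder F b k.+1 Fb.
have bound z : z != 0 -> `|z| <= 4^-1 -> `|b k| <= (C + D) * `|z|.
  move=> z0 z4; rewrite -(@ler_pM2r _ (`|z| ^+ k)) ?exprn_gt0 ?normr_gt0//.
  rewrite -mulrA -exprS -normrX -normrM.
  have := FD z z4; rewrite big_nat_recr//= big_nat big1 ?add0r; last first.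
    by move=> i ik; rewrite IH ?mul0r// (leq_trans (ltnW _) kn).
  move=> FDz; rewrite mulrDl.
  rewrite -[b k * _](subKr (F z)) (le_trans (ler_normB _ _))// lerD//.
  apply: (le_trans (FC z z4)); apply: ler_wpM2l => //.
  rewrite ler_wiXn2l// (le_trans z4)// invf_le1 ?ltr0n// ler1n//.
apply/eqP; rewrite -normr_eq0; apply/negPn/negP => bk.
have bk0 : 0 < `|b k| by rewrite lt_def bk normr_ge0.
(* Adding [|b k|] makes [E] positive and at least [|b k|], so that [t = |b k| / (4 * E)] satisfies
   [t <= 4^-1] while [(C + D) * t <= E * t = |b k| / 4], which contradicts [bound]. *)
set E := C + D + `|b k|.
have E0 : 0 < E by rewrite ltr_wpDl ?addr_ge0.
pose t : Cplx R := `|b k| / (4 * E).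
have t0 : 0 < t by rewrite divr_gt0 ?mulr_gt0.
have tE : E * t = `|b k| / 4.
  by rewrite /t; field; rewrite ?gt_eqF.
have t4 : t <= 4^-1.
  rewrite -(ler_pM2l E0) tE ler_pM2r ?invr_gt0//.
  by rewrite /E lerDr addr_ge0.
have tnorm : `|t| = t by rewrite ger0_norm ?ltW.
have bkt : `|b k| <= (C + D) * t.
  by rewrite -tnorm; apply: bound; rewrite ?tnorm ?gt_eqF.
have : (C + D) * t < `|b k|.
  apply: (@le_lt_trans _ _ (E * t)).
    by rewrite ler_wpM2r ?ltW// /E ltrDl.
  by rewrite tE ltr_pdivrMr// ltr_pMr// ltr1n.
by move/(le_lt_trans bkt); rewrite ltxx.
Qed.

Lemma power_expansion_sub F G a b : power_expansion F a ->
  power_expansion G b -> power_expansion (F \- G) (fun n => a n - b n).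
Proof.
move=> Fa Gb z zD.
rewrite (_ : series _ = series (fun n => a n * z ^+ n) \-
    series (fun n => b n * z ^+ n)); first exact: cvgB (Fa z zD) (Gb z zD).
apply/funext => n; rewrite /series /= -sumrB.
by apply: eq_bigr => i _; rewrite mulrBl.
Qed.

(** The difference of the two series expands the zero function, which is [O(z ^+ n.+1)] with
    constant [0] for every [n]. *)
Lemma power_expansion_unique F a b :
  power_expansion F a -> power_expansion F b -> a = b.
Proof.
move=> Fa Fb; apply/funext => n; apply/eqP; rewrite -subr_eq0; apply/eqP.
apply: (power_series_coef_eq0 _ _ 0 n (power_expansion_sub _ _ _ _ Fa Fb)) => //.
by move=> z _ /=; rewrite subrr normr0 mul0r.
Qed.

(** By uniqueness the choice made by [xget] is immaterial, so [coefs] can be read off any known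
    expansion. *)
Lemma coefsE F a : power_expansion F a -> coefs F = a.
Proof.
move=> Fa; apply: (@power_expansion_unique F) => //.
by rewrite /coefs; case: xgetP => [b -> //|/(_ a)].
Qed.

Lemma H22_expansion (f : H22 R) : power_expansion f (coefs f).
Proof.
by case: f => f /= /asboolP[_ _ [a [fa _]]]; rewrite (coefsE _ _ fa).
Qed.

Lemma H22_finite_norm (f : H22 R) : finite_H22_norm (coefs f).
Proof.
by case: f => f /= /asboolP[_ _ [a [fa na]]]; rewrite (coefsE _ _ fa).
Qed.

End PowerSeries.

(** * Elements of [H22]: monomials, inner products with them, and the conjugation [J] *)

Section Restriction.
Variable R : realType.
Implicit Types (g : Cplx R -> Cplx R) (a : nat -> Cplx R) (z : Cplx R).

Lemma disk_near z : disk z -> \forall y \near z, disk y.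
Proof.
move=> zD; apply/nbhs_ballP; exists (1 - `|z|); first by rewrite /= subr_gt0.
move=> y; rewrite /ball /= ltrBrDl => zy.
by rewrite /disk /= -(subKr z y) (le_lt_trans (ler_normB _ _)).
Qed.

Lemma disk0 : disk (0 : Cplx R).
Proof. by rewrite /disk /= normr0. Qed.

(** Elements of [H22] must vanish off the disk, so a function on the plane is cut off before being
    packed. *)
Definition restrict_disk g : Cplx R -> Cplx R :=
  fun z => if `|z| < 1 then g z else 0.

Lemma restrict_diskE g z : disk z -> restrict_disk g z = g z.
Proof. by rewrite /restrict_disk /disk /= => ->. Qed.

Lemma power_expansion_eq {g h a} : (forall z, disk z -> h z = g z) ->
  power_expansion g a -> power_expansion h a.
Proof. by move=> hg ga z zD; rewrite hg//; exact: ga. Qed.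

Lemma in_H22_restrict_disk g a : holomorphic_on_disk g ->
  power_expansion g a -> finite_H22_norm a -> in_H22 (restrict_disk g).
Proof.
move=> hg ga na; split.
- by move=> z /negP /negbTE zD; rewrite /restrict_disk zD.
- move=> z zD; apply: (@near_eq_derivable _ _ _ g); last exact: hg.
  near=> y; rewrite restrict_diskE//; near: y; exact: disk_near.
- exists a; split; last exact: na.
  by apply: power_expansion_eq ga => z; exact: restrict_diskE.
Unshelve. all: by end_near. Qed.

Lemma H22_restrict_subproof g a : holomorphic_on_disk g ->
  power_expansion g a -> finite_H22_norm a -> restrict_disk g \in @H22_pred R.
Proof. by move=> hg ga na; apply/asboolP; exact: in_H22_restrict_disk ga na. Qed.

Lemma monomial_expansion n :
  power_expansion (fun z : Cplx R => z ^+ n) (fun k => (k == n)%:R).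
Proof.
move=> z _; apply: cvg_near_cst; exists n.+1 => // m /= nm.
rewrite /series /= (big_nat_widen _ _ _ _ _ (leqnn m)) big_mkord.
rewrite (bigD1 (Ordinal nm))//= eqxx mul1r big1 ?addr0// => i.
by rewrite -val_eqE /= => /andP[_ /negbTE ->]; rewrite mul0r.
Qed.

Lemma monomial_finite_norm n : finite_H22_norm (fun k => (k == n)%:R : Cplx R).
Proof.
rewrite /finite_H22_norm (@nneseries_split _ _ _ n.+1)//; last first.
  by move=> k _; rewrite lee_fin mulr_ge0 ?weight_ge0 ?sqr_ge0.
rewrite [X in (_ + X)%E]eseries0 ?adde0; last first.
  move=> k nk _; rewrite (@gtn_eqF n k nk).
  by rewrite /modulus normr0 /= expr0n /= mulr0.
by rewrite sumEFin ltry.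
Qed.

Lemma monomial_subproof n :
  restrict_disk (fun z => z ^+ n) \in @H22_pred R.
Proof.
apply: H22_restrict_subproof; last exact: monomial_finite_norm.
  by move=> z _; exact: exprn_derivable.
exact: monomial_expansion.
Qed.

Definition monomial n : H22 R := MkH22 (monomial_subproof n).

Lemma coefs_monomial n : coefs (monomial n) = fun k => (k == n)%:R.
Proof.
apply: coefsE; apply: power_expansion_eq (monomial_expansion n) => z.
exact: restrict_diskE.
Qed.

Lemma H22_ext (f g : H22 R) : (forall z, disk z -> f z = g z) -> f = g.
Proof.
move=> fg; apply: val_inj; apply/funext => z /=.
have [/fg//|zD] := pselect (disk z).
case: f g {fg} => f /= /asboolP[f0 _ _] [g /= /asboolP[g0 _ _]].
by rewrite f0// g0.
Qed.

Lemma H22_ip_monomialr (f : H22 R) n :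
  H22_ip f (monomial n) = weight (Cplx R) n * coefs f n.
Proof.
(* Only the term of index [n] is nonzero, so the partial sums are constant from [n.+1] on. *)
apply: lim_near_cst => //; exists n.+1 => // m /= nm.
rewrite coefs_monomial /series /= big_mkord (bigD1 (Ordinal nm))//= eqxx.
rewrite conjC1 mulr1 big1 ?addr0// => i.
by rewrite -val_eqE /= => /negbTE ->; rewrite conjC0 mulr0.
Qed.

Lemma H22_ip_monomiall (f : H22 R) n :
  H22_ip (monomial n) f = weight (Cplx R) n * (coefs f n)^*.
Proof.
apply: lim_near_cst => //; exists n.+1 => // m /= nm.
rewrite coefs_monomial /series /= big_mkord (bigD1 (Ordinal nm))//= eqxx.
rewrite mulr1 big1 ?addr0// => i.
by rewrite -val_eqE /= => /negbTE ->; rewrite mulr0 mul0r.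
Qed.

Lemma coefs_J (f : H22 R) : coefs (J f) = fun n => (coefs f n)^*.
Proof.
apply: coefsE => z zD.
rewrite (_ : series _ = fun n => (series (fun k => coefs f k * z^* ^+ k) n)^*).
  by apply: cvg_conj; apply: H22_expansion; exact: disk_conj.
apply/funext => n; rewrite /series /= rmorph_sum; apply: eq_bigr => i _.
by rewrite rmorphM rmorphXn /= conjCK.
Qed.

Lemma JK (f : H22 R) : J (J f) = f.
Proof. by apply: H22_ext => z _; rewrite /J /= /conj_fun !conjCK. Qed.

Lemma J_monomial n : J (monomial n) = monomial n.
Proof.
apply: H22_ext => z zD /=.
rewrite /conj_fun !restrict_diskE//; last exact: disk_conj.
by rewrite rmorphXn /= conjCK.
Qed.

Lemma H22_ip_J (f g : H22 R) : H22_ip (J f) (J g) = H22_ip g f.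
Proof.
rewrite /H22_ip !coefs_J; congr (limn (series _)); apply/funext => n.
by rewrite conjCK mulrAC.
Qed.

Lemma J_conjugation : conjugation (@H22_ip R) (@J R).
Proof.
split; [|exact: JK|exact: H22_ip_J].
move=> c f g; apply: H22_ext => z _.
by rewrite /J /= /conj_fun /= rmorphD /= rmorphM.
Qed.

End Restriction.

(** * Complex symmetry forces a linear symbol *)

Section Necessity.
Variables (R : realType) (phi : Cplx R -> Cplx R) (T S : H22 R -> H22 R).
Hypothesis Tphi : is_composition_operator phi T.
Hypothesis adjTS : is_adjoint (@H22_ip R) T S.
Hypothesis TJ : forall x, T (J x) = J (S x).

Let b n := coefs (T (monomial R n)).

(** As [J] fixes monomials, [T e_m = J (S e_m)]: the coefficients of [S e_m] are the conjugates of
    [b m], and the second slot of the inner product conjugates them back. *)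
Lemma composition_matrix_sym n m :
  weight (Cplx R) m * b n m = weight (Cplx R) n * b m n.
Proof.
have := adjTS (monomial R n) (monomial R m).
rewrite H22_ip_monomialr H22_ip_monomiall => ->.
by rewrite /b -{2}(J_monomial R m) TJ coefs_J.
Qed.

Lemma composition_monomial n z : disk z -> disk (phi z) ->
  T (monomial R n) z = phi z ^+ n.
Proof. by move=> zD pzD; rewrite Tphi//= restrict_diskE. Qed.

Hypothesis phiD : maps_disk_into_disk phi.

Lemma composition_expansion n : power_expansion (fun z => phi z ^+ n) (b n).
Proof.
apply: power_expansion_eq (H22_expansion _ (T (monomial R n))) => z zD.
by rewrite composition_monomial//; exact: phiD.
Qed.

(** [T] fixes the constant [1], whose coefficient of order one is zero; symmetry at [(0, 1)]
    transfers this to [b 1 0]. *)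
Lemma composition_coef0 : b 1 0 = 0.
Proof.
have Tone : T (monomial R 0) = monomial R 0.
  apply: H22_ext => z zD.
  by rewrite composition_monomial ?expr0//= ?restrict_diskE ?expr0//; exact: phiD.
have := composition_matrix_sym 0 1.
rewrite {1}/b Tone coefs_monomial /= mulr0 => /esym/eqP.
by rewrite mulf_eq0 (negbTE (weight_neq0 _ _)) => /eqP.
Qed.

(** A weak local form of the Schwarz lemma: the remainder of order one of [phi], whose constant term
    is zero. *)
Lemma composition_Schwarz_bound : exists2 C : Cplx R, 0 <= C &
  forall z, `|z| <= 4^-1 -> `|phi z| <= C * `|z|.
Proof.
have [C C0 phiC] := power_series_remainder _ _ _ 1 (composition_expansion 1).
exists C => // z /phiC.
by rewrite big_nat1 composition_coef0 mul0r subr0 !expr1.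
Qed.

Lemma composition_coef_ge2 m : (1 < m)%N -> b 1 m = 0.
Proof.
move=> m1; have [C C0 phiC] := composition_Schwarz_bound.
have bm1 : b m 1 = 0.
  apply: (power_series_coef_eq0 _ _ _ (C ^+ m) 1 (composition_expansion m)) => //.
    by rewrite exprn_ge0.
  move=> z z4; rewrite normrX.
  apply: (@le_trans _ _ ((C * `|z|) ^+ m)).
    by rewrite lerXn2r ?nnegrE ?mulr_ge0 ?phiC.
  (* Since [|z| <= 1] and [2 <= m], [|z| ^+ m <= |z| ^+ 2], the order that annihilates the
     coefficient of index [1]. *)
  rewrite exprMn ler_wpM2l ?exprn_ge0//.
  by rewrite ler_wiXn2l// (le_trans z4)// invf_le1 ?ltr0n// ler1n.
have := composition_matrix_sym 1 m; rewrite bm1 mulr0 => /eqP.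
by rewrite mulf_eq0 (negbTE (weight_neq0 _ _)) => /eqP.
Qed.

Lemma composition_symbol_linear z : disk z -> phi z = b 1 1 * z.
Proof.
move=> zD; have phiz : (series (fun n => b 1 n * z ^+ n) @ \oo --> phi z)%classic.
  exact: (composition_expansion 1 z zD).
apply: (cvg_unique (@norm_hausdorff _ _) phiz).
apply: cvg_near_cst; exists 2%N => // -[|[|m]] //= _.
rewrite /series /= 2?big_nat_recl//= composition_coef0 mul0r add0r expr1.
by rewrite big1 ?addr0// => i _; rewrite composition_coef_ge2// mul0r.
Qed.

Lemma composition_symbol :
  phi 0 = 0 /\ forall z, disk z -> phi z = derive1 phi 0 * z.
Proof.
split; first by rewrite composition_symbol_linear ?mulr0//; exact: disk0.
suff -> : derive1 phi 0 = b 1 1 by exact: composition_symbol_linear.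
(* Linearity is known on the disk only, a neighbourhood of [0], which suffices for the derivative
   there. *)
rewrite derive1E (@near_eq_derive _ _ _ _ (b 1 1 \*: id)).
  by rewrite deriveZ ?derive_id; [rewrite /GRing.scale /= mulr1|exact: derivable_id].
near=> z; rewrite composition_symbol_linear//; near: z.
by apply: disk_near; exact: disk0.
Unshelve. all: by end_near. Qed.

End Necessity.

(** * The norm as a real series, and its monotonicity in the moduli of the coefficients *)

Section Norm.
Variable R : realType.
Implicit Types f g : H22 R.

Let sqnorm_partial f : nat -> R :=
  series (fun n => weight R n * modulus (coefs f n) ^+ 2).

Lemma sqnorm_term_ge0 f n : 0 <= weight R n * modulus (coefs f n) ^+ 2.
Proof. by rewrite mulr_ge0 ?weight_ge0 ?sqr_ge0. Qed.

(** The finite extended-real sum bounds the nondecreasing real partial sums. *)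
Lemma sqnorm_cvg f : cvgn (sqnorm_partial f).
Proof.
have := H22_finite_norm _ f; rewrite /finite_H22_norm.
set s := (\sum_(_ <= _ <oo) _)%E => s_fin.
have s_ge n : ((sqnorm_partial f n)%:E <= s)%E.
  rewrite /sqnorm_partial /series /= -sumEFin.
  by apply: nneseries_lim_ge => k _ _; rewrite lee_fin sqnorm_term_ge0.
have s_num : s \is a fin_num.
  rewrite ge0_fin_numE//; apply: le_trans (s_ge 0%N).
  by rewrite /sqnorm_partial /series /= big_geq.
apply: nondecreasing_is_cvgn.
  apply/nondecreasing_seqP => n; rewrite /sqnorm_partial /series /= big_nat_recr//=.
  by rewrite lerDl sqnorm_term_ge0.
exists (fine s) => _ [n _ <-].
by rewrite -lee_fin fineK.
Qed.

Lemma cvg_real_complex (u : nat -> R) (l : R) : (u @ \oo --> l)%classic ->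
  ((fun n => (u n)%:C%C : Cplx R) @ \oo --> (l%:C%C : Cplx R))%classic.
Proof.
move=> /cvgrPdist_lt ul; apply/cvgrPdist_lt => e e0.
(* A positive element of [Cplx R] is real, so a complex tolerance is the image of a real one. *)
have eE : e = (complex.Re e)%:C%C by rewrite RRe_real// gtr0_real.
near=> n; rewrite eE -rmorphB normc_def /= expr0n /= addr0 sqrtr_sqr ltcR.
by near: n; apply: ul; rewrite -ltcR -eE.
Unshelve. all: by end_near. Qed.

(** Each term of [H22_ip f f] is real, being a weight times a squared modulus, so the complex limit
    is the image of the real one. *)
Lemma hnormE f : hnorm (@H22_ip R) f = Num.sqrt (limn (sqnorm_partial f)).
Proof.
rewrite /hnorm /H22_ip; congr (Num.sqrt _).
rewrite (_ : series _ = fun n => (sqnorm_partial f n)%:C%C).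
  have H := cvg_real_complex _ _ (sqnorm_cvg f).
  by rewrite (cvg_lim _ H).
apply/funext => n; rewrite /sqnorm_partial /series /= rmorph_sum.
apply: eq_bigr => i _; rewrite -mulrA -normCK modulusE rmorphM rmorphXn /=.
by rewrite /weight rmorphM fmorphV rmorphXn /= !rmorph_nat.
Qed.

Lemma hnorm_le f g : (forall n, modulus (coefs f n) <= modulus (coefs g n)) ->
  hnorm (@H22_ip R) f <= hnorm (@H22_ip R) g.
Proof.
move=> fg; rewrite !hnormE; apply: ler_wsqrtr.
apply: (ler_lim (sqnorm_cvg f) (sqnorm_cvg g)).
apply: nearW => n; apply: ler_sum => i _; apply: ler_wpM2l; first exact: weight_ge0.
by rewrite ler_sqr ?nnegrE ?modulus_ge0.
Qed.

End Norm.

(** * Dilations as bounded operators, and the converse *)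

Section Dilation.
Variables (R : realType) (c : Cplx R).
Hypothesis cD : disk c.

Lemma disk_dilation z : disk z -> disk (c * z).
Proof.
rewrite /disk /= normrM => zD; apply: (le_lt_trans _ zD).
by rewrite ler_piMl// ltW.
Qed.

Lemma dilation_holomorphic (f : Cplx R -> Cplx R) : holomorphic_on_disk f ->
  holomorphic_on_disk (fun z => f (c * z)).
Proof.
move=> fh z zD; apply/derivable1_diffP.
have -> : (fun z => f (c * z)) = f \o (c \*: id) by [].
apply: differentiable_comp.
  by apply: differentiableZ; apply/derivable1_diffP; exact: derivable_id.
by apply/derivable1_diffP; apply: fh; exact: disk_dilation.
Qed.

Lemma dilation_expansion (f : Cplx R -> Cplx R) a : power_expansion f a ->
  power_expansion (fun z => f (c * z)) (fun n => c ^+ n * a n).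
Proof.
move=> fa z zD; have := fa _ (disk_dilation _ zD).
rewrite (_ : (fun n => a n * (c * z) ^+ n) = (fun n => c ^+ n * a n * z ^+ n))//.
by apply/funext => n; rewrite exprMn mulrCA mulrA.
Qed.

Lemma modulus_dilation x n : modulus (c ^+ n * x) <= modulus x.
Proof.
by rewrite -lecR -!modulusE normrM ler_piMl// normrX exprn_ile1// ltW.
Qed.

Lemma dilation_finite_norm a : finite_H22_norm a ->
  finite_H22_norm (fun n => c ^+ n * a n).
Proof.
apply: le_lt_trans; apply: lee_nneseries => [n _ _|n _].
  by rewrite lee_fin mulr_ge0 ?weight_ge0 ?sqr_ge0.
rewrite lee_fin ler_wpM2l ?weight_ge0// ler_sqr ?nnegrE ?modulus_ge0//.
exact: modulus_dilation.
Qed.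

Lemma dilation_subproof (f : H22 R) :
  restrict_disk R (fun z => f (c * z)) \in @H22_pred R.
Proof.
apply: H22_restrict_subproof.
- by apply: dilation_holomorphic; case: f => f /= /asboolP[].
- by apply: dilation_expansion; exact: H22_expansion.
- by apply: dilation_finite_norm; exact: H22_finite_norm.
Qed.

Definition dilation (f : H22 R) : H22 R := MkH22 (dilation_subproof f).

Lemma dilationE f z : disk z -> dilation f z = f (c * z).
Proof. by move=> zD /=; rewrite restrict_diskE. Qed.

Lemma coefs_dilation f : coefs (dilation f) = fun n => c ^+ n * coefs f n.
Proof.
apply: coefsE; apply: power_expansion_eq (dilation_expansion _ _ (H22_expansion _ f)).
by move=> z zD; rewrite dilationE.
Qed.

Lemma dilation_bounded_linear : bounded_linear (@H22_ip R) dilation.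
Proof.
split.
  move=> k f g; apply: H22_ext => z zD.
  have -> : (k *: dilation f + dilation g) z =
    k * dilation f z + dilation g z by [].
  by rewrite !dilationE.
(* A dilation is a contraction, because [|c ^+ n| <= 1]. *)
exists 1 => f; rewrite mul1r; apply: hnorm_le => n.
by rewrite coefs_dilation modulus_dilation.
Qed.

End Dilation.

Lemma dilation_complex_symmetric (R : realType) (a : Cplx R) : disk a ->
  composition_complex_symmetric (fun z => a * z) (@J R).
Proof.
move=> aD; have acD := disk_conj aD.
exists (dilation R a aD); split; first by move=> f z; exact: dilationE.
split; [exact: J_conjugation|exact: dilation_bounded_linear|].
exists (dilation R a^* acD); split.
  move=> f g; rewrite /H22_ip !coefs_dilation; congr (limn (series _)).
  apply/funext => n; rewrite rmorphM rmorphXn /= conjCK; ring.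
move=> f; apply: H22_ext => z zD.
have JE h x : J h x = (h x^*)^* :> Cplx R by [].
(* Both sides are the conjugate of [f] at [(a * z)^* = a^* * z^*]. *)
rewrite dilationE// !JE dilationE; last exact: disk_conj.
by rewrite rmorphM.
Qed.

Theorem theorem4p2 (R : realType) :
  (forall phi : Cplx R -> Cplx R,
     holomorphic_on_disk phi -> maps_disk_into_disk phi ->
     composition_complex_symmetric phi (@J R) ->
     phi 0 = 0 /\ forall z, disk z -> phi z = derive1 phi 0 * z)
  /\
  (forall a : Cplx R, disk a ->
     maps_disk_into_disk (fun z => a * z) ->
     composition_complex_symmetric (fun z => a * z) (@J R)).
Proof.
split=> [phi _ phiD [T [Tphi [_ _ [S [adjTS TJ]]]]]|a aD _].
  exact: composition_symbol Tphi adjTS TJ phiD.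
exact: dilation_complex_symmetric.
Qed.
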